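(* Let $k,t\ge 1$ be integers. The map $\Theta_t\colon \mathrm{Conf}(\mathbb C,k)\to\mathbb C^{\binom kt}$ restricts to a map $M(t,k)\to \mathrm{Conf}(\mathbb C,\binom kt)$, and the commutative square of topological spaces with top map $M(t,k)\to \mathrm{Conf}(\mathbb C,\binom kt)$ (this restriction), left map the inclusion $M(t,k)\to \mathrm{Conf}(\mathbb C,k)$, right map the inclusion $j\colon \mathrm{Conf}(\mathbb C,\binom kt)\to\mathbb C^{\binom kt}$, and bottom map $\Theta_t$, is a pull-back (cartesian) square.
   Context: $\mathrm{Conf}(\mathbb C,m)\subset \mathbb C^m$ is the space of ordered $m$-tuples of pairwise distinct points of $\mathbb C$ (a single point if $m=0$). For $k>t$, $M(t,k)\subset\mathbb C^k$ is the subspace of all $(x_1,\dots,x_k)$ such that $\sum_{i\in I}x_i\neq\sum_{j\in J}x_j$ (equivalently, the centroids differ) for all distinct $t$-element subsets $I\ne J$ of $\{1,\dots,k\}$; this is contained in $\mathrm{Conf}(\mathbb C,k)$. For $k\le t$, $M(t,k):=\mathrm{Conf}(\mathbb C,k)$. The map $\Theta_t$ is $\Theta_t(z_1,\dots,z_k)=(z_{i_1}+z_{i_2}+\cdots+z_{i_t})_{i_1<i_2<\cdots<i_t}$, the coordinates being indexed by the $t$-element subsets of $\{1,\dots,k\}$ in lexicographic order. *)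

(* Defs.v *)
From HB Require Import structures.
From mathcomp Require Import all_boot all_order all_algebra.
From mathcomp Require Import complex.
From mathcomp Require Import boolp classical_sets functions reals topology.

Set Implicit Arguments.
Unset Strict Implicit.
Unset Printing Implicit Defensive.

Import Order.TTheory GRing.Theory Num.Theory.

Local Open Scope classical_set_scope.
Local Open Scope ring_scope.

(* Universal property in the category of topological spaces of the square
         top
      P -----> Y
      |        |
 left |        | right
      v        v
      X -----> Z
        bottom                                                              *)
Definition is_pullback (P X Y Z : topologicalType)
    (top : P -> Y) (left : P -> X) (right : Y -> Z) (bottom : X -> Z) : Prop :=
  [/\ [/\ continuous top, continuous left, continuous right
        & continuous bottom],
      right \o top = bottom \o left
    & forall (W : topologicalType) (u : W -> Y) (v : W -> X),
        continuous u -> continuous v -> right \o u = bottom \o v ->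
        exists! w : W -> P,
          [/\ continuous w, top \o w = u & left \o w = v] ].

(* R[i]^o is R[i] as a type; it is the copy on which the library puts the
   topology of the modulus.  Row vectors over it carry the product topology. *)
Definition Conf (R : realType) (m : nat) : set 'rV[R[i]^o]_m :=
  [set x : 'rV[R[i]^o]_m | forall i j : 'I_m, i != j -> x 0 i <> x 0 j].
Arguments Conf : clear implicits.

Definition M (R : realType) (t k : nat) : set 'rV[R[i]^o]_k :=
  if (t < k)%N then
    [set x : 'rV[R[i]^o]_k | forall I J : {set 'I_k},
       #|I| = t -> #|J| = t -> I != J ->
       \sum_(i in I) x 0 i <> \sum_(j in J) x 0 j]
  else Conf R k.
Arguments M : clear implicits.

(* A finite set of indices is compared through its increasing enumeration. *)
Definition lex_le (k : nat) (I J : {set 'I_k}) : bool :=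
  (([seq val i | i <- enum I] : seqlexi nat)
     <= [seq val j | j <- enum J])%O.

Definition lex_subsets_seq (k t : nat) : seq {set 'I_k} :=
  sort (@lex_le k) (enum [set I : {set 'I_k} | #|I| == t]%SET).

Lemma size_lex_subsets (k t : nat) : size (lex_subsets_seq k t) == 'C(k, t).
Proof. by rewrite size_sort -cardE card_draws card_ord. Qed.

Definition lex_subsets (k t : nat) : 'C(k, t).-tuple {set 'I_k} :=
  Tuple (size_lex_subsets k t).

Definition Theta (R : realType) (t k : nat) (z : 'rV[R[i]^o]_k) :
    'rV[R[i]^o]_('C(k, t)) :=
  \row_(n < 'C(k, t)) \sum_(i in tnth (lex_subsets k t) n) z 0 i.
Arguments Theta : clear implicits.

(* Main.v *)
(* As all maps but Theta_t are inclusions or restrictions, the square is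
   cartesian as soon as Theta_t is continuous and M(t, k) is the intersection
   of Conf(C, k) with the preimage of Conf(C, 'C(k, t)).  For t < k, two equal
   coordinates x_i = x_j give equal sums over A + i and A + j, where A is any
   set of t - 1 further indices, so M(t, k) lies in Conf(C, k).  For k <= t,
   'C(k, t) <= 1 and Conf(C, 'C(k, t)) is the whole space. *)
Require Import Defs.
From mathcomp Require Import all_boot all_order all_algebra.
From mathcomp Require Import complex.
From mathcomp Require Import boolp classical_sets functions reals topology.
From mathcomp Require Import normedtype zify.

Import Order.TTheory GRing.Theory Num.Theory.

Local Open Scope classical_set_scope.
Local Open Scope ring_scope.

Lemma set_val_continuous {X : topologicalType} (A : set X) :
  continuous (set_val : A -> X).
Proof. exact: initial_continuous. Qed.

Lemma sigL_continuous {X Y : topologicalType} (A : set X) (f : X -> Y) :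
  continuous f -> continuous (sigL A f).
Proof.
move=> cf x; apply: (@continuous_comp _ _ _ (set_val : A -> X) f).
  exact: set_val_continuous.
exact: cf.
Qed.

Lemma set_val_inj {T : Type} (A : set T) : injective (set_val : A -> T).
Proof. exact: val_inj. Qed.

(** A competing pair [u], [v] satisfies [f (v x) = u x] in [B] with [v x] in [A], so [v] already
    takes its values in [C]. The mediating map is [v] corestricted to [C]: it is continuous because
    [C] carries the initial topology, and unique because inclusions are injective. *)
Lemma subspace_pullback {X Y : topologicalType} (C A : set X) (B : set Y)
    (f : X -> Y) (CA : C `<=` A) (fCB : set_fun C B f) :
  continuous f -> (forall x, A x -> B (f x) -> C x) ->
  is_pullback (sigLR (mkfun_fun fCB) : C -> B) (subfun CA : C -> A)
              (set_val : B -> Y) (sigL A f).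
Proof.
move=> cf CP; split.
- split.
  + by apply: continuous_comp_initial; exact: sigL_continuous.
  + apply: continuous_comp_initial => x.
    exact: (@set_val_continuous _ C x).
  + exact: set_val_continuous.
  + exact: sigL_continuous.
- by apply/funext.
move=> W u v cu cv uv.
have inC x : C (set_val (v x)).
  apply: CP; first exact: set_valP.
  have /= <- := congr1 (@^~ x) uv; exact: set_valP.
pose w x : C := SigSub (mem_set (inC x)).
exists w; split.
  split.
  + apply: continuous_comp_initial => x.
    by apply: (@continuous_comp _ _ _ v); [exact: cv|exact: set_val_continuous].
  + apply/funext => x; apply: set_val_inj.
    by have /= -> := congr1 (@^~ x) uv.
  + by apply/funext => x; apply: set_val_inj.
move=> w' [_ _ w'v]; apply/funext => x; apply: set_val_inj.
exact: (congr1 (fun g => set_val (g x)) (esym w'v)).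
Qed.

Lemma rV_continuous {W T : topologicalType} (n : nat) (g : W -> 'rV[T]_n) :
  (forall j, continuous (fun w => g w 0 j)) -> continuous g.
Proof.
(* A neighbourhood of a row contains a box [P]; finitely many coordinate conditions that hold near
   [w] hold there simultaneously. *)
move=> cg w U [P Pg PU]; rewrite nbhs_simpl /=.
have : \forall x \near w, forall j : 'I_n, P 0 j (g x 0 j).
  by apply: filter_forall => j; exact: cg.
by apply: filterS => x Px; apply: PU => i j; rewrite ord1.
Qed.

Lemma rV_coord_continuous {T : topologicalType} (n : nat) (j : 'I_n) :
  continuous (fun z : 'rV[T]_n => z 0 j).
Proof.
move=> z U Uz.
(* The box constrains column [j] only. *)
exists (fun i' j' => if j' == j then U else setT) => [i' j'|y Py].
  by case: eqP => [->|_]; [rewrite ord1|exact: filterT].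
by have := Py 0 j; rewrite eqxx.
Qed.

Lemma Theta_continuous (R : realType) (t k : nat) : continuous (Theta R t k).
Proof.
apply: rV_continuous => n.
have -> : (fun z => Theta R t k z 0 n) =
    (fun z => \sum_(i in tnth (lex_subsets k t) n) z 0 i).
  by apply/funext => z; rewrite mxE.
apply: continuous_big => [|i _]; first exact: (@tvs.add_continuous R[i]^o).
exact: rV_coord_continuous.
Qed.

Lemma mem_lex_subsets (k t : nat) (I : {set 'I_k}) :
  (I \in lex_subsets k t) = (#|I| == t).
Proof. by rewrite mem_sort mem_enum inE. Qed.

Lemma lex_subsets_uniq (k t : nat) : uniq (lex_subsets k t).
Proof. by rewrite sort_uniq enum_uniq. Qed.

Lemma M_sub_Conf (R : realType) (k t : nat) :
  (0 < t)%N -> M R t k `<=` Conf R k.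
Proof.
rewrite /M => t0; case: ltnP => [tk|_]; last exact: subset_refl.
move=> x Mx i j ij xij.
have [A AD At] : exists2 A : {set 'I_k},
    A \subset ~: [set i; j]%SET & #|A| = t.-1.
  (* The complement of the pair has [k - 2] elements, and [t - 1 <= k - 2] is exactly [t < k]. *)
  suff /card_geqP [s [us sz sD]] : (t.-1 <= #|~: [set i; j]%SET|)%N.
    exists [set:: s]%SET; last by rewrite cardsE (card_uniqP us).
    by apply/fintype.subsetP => y; rewrite inE; exact: sD.
  by rewrite cardsCs finset.setCK cards2 ij card_ord leq_subRL; lia.
have [iA jA] : i \notin A /\ j \notin A.
  by split; apply/negP => /(fintype.subsetP AD); rewrite !inE eqxx ?orbT.
apply: (Mx (i |: A)%SET (j |: A)%SET).
- by rewrite cardsU1 iA At add1n prednK.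
- by rewrite cardsU1 jA At add1n prednK.
- apply/eqP => /setP /(_ i); rewrite !inE eqxx (negbTE ij) /=.
  by rewrite (negbTE iA).
- by rewrite !big_setU1 //= xij.
Qed.

Lemma Theta_M_Conf (R : realType) (k t : nat) (x : 'rV[R[i]^o]_k) :
  M R t k x -> Conf R 'C(k, t) (Theta R t k x).
Proof.
rewrite /M; case: ltnP => [tk Mx|kt _] m n mn; last first.
  (* With at most one coordinate, [m != n] is absurd. *)
  have kt1 : ('C(k, t) <= 1)%N.
    by move: kt; rewrite leq_eqVlt => /predU1P [->|/bin_small ->]; rewrite ?binn.
  by move: mn (ltn_ord m) (ltn_ord n); rewrite -val_eqE /=; lia.
rewrite !mxE; apply: Mx; try by apply/eqP; rewrite -mem_lex_subsets mem_tnth.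
(* Distinct positions hold distinct subsets, since the enumeration has no repetition. *)
by apply: contra_neq mn; move/(tuple_uniqP _ (lex_subsets_uniq k t)).
Qed.

(** For [t < k], every [t]-element subset occurs in the enumeration, so the sums over [I] and [J]
    are two coordinates of [Theta R t k x], at different positions when [I != J]. *)
Lemma Conf_Theta_M (R : realType) (k t : nat) (x : 'rV[R[i]^o]_k) :
  Conf R k x -> Conf R 'C(k, t) (Theta R t k x) -> M R t k x.
Proof.
rewrite /M; case: ltnP => // tk _ Cx I J /eqP + /eqP.
rewrite -!mem_lex_subsets => /tnthP [m ->] /tnthP [n ->] mn.
have /Cx : m != n by apply: contra_neq mn => ->.
by rewrite !mxE.
Qed.

Theorem proposition1p1 (R : realType) (k t : nat)
    (hk : (1 <= k)%N) (ht : (1 <= t)%N) :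
  exists (MConf : M R t k `<=` Conf R k)
         (ThetaM : set_fun (M R t k) (Conf R 'C(k, t)) (Theta R t k)),
    is_pullback
      (sigLR [fun of mkfun ThetaM] : M R t k -> Conf R 'C(k, t))
      (subfun MConf : M R t k -> Conf R k)
      (set_val : Conf R 'C(k, t) -> 'rV[R[i]^o]_('C(k, t)))
      (sigL (Conf R k) (Theta R t k)).
Proof.
exists (@M_sub_Conf R k t ht), (@Theta_M_Conf R k t).
apply: subspace_pullback; first exact: Theta_continuous.
exact: Conf_Theta_M.
Qed.
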